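(* Let $z\in\mathbb{C}^n$, $\tilde z=[z^T,1]^T\in\mathbb{C}^{n+1}$, $\varphi(z)=\mathrm{Re}(d\tilde z)$ and let $\mu_{\varphi(z)}=\mathrm{Re}(\mu_d\tilde z)$ be its mean. For any $p\in(0,1)$, if $\mu_{\varphi(z)}\le 0$, then the distributionally robust complex chance constraint $$\inf_{d\in(\mu_d,L)_N}\mathbb{P}[\varphi(z)\le 0]\ge p$$ holds if $$\sqrt{2\ln\left(\frac{1}{1-p}\right)}\ \|L\tilde z\|+\mu_{\varphi(z)}\le 0.$$
   Context: $(\mu_d,L)_N$ denotes the family of distributions of random vectors $d=\mu_d+w$ with $n+1$ complex entries, where $\mu_d$ is a fixed complex vector and $w$ is a zero-mean complex random vector with independent components satisfying $|w_i|\le l_i$, $i=1,\dots,n+1$; here $l_i\ge0$ are given and $L=\mathrm{diag}(l_1,\dots,l_{n+1})$. The product is $d\tilde z=\sum_j d_j\tilde z_j$, and $\|\cdot\|$ is the Euclidean norm on $\mathbb{C}^{n+1}$. *)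

(* Defs.v *)
From HB Require Import structures.
From mathcomp Require Import all_boot all_order all_algebra.
From mathcomp Require Import all_classical all_reals all_analysis.
From mathcomp Require Export complex.

Set Implicit Arguments.
Unset Strict Implicit.
Unset Printing Implicit Defensive.

Import Order.TTheory GRing.Theory Num.Theory.
Import numFieldNormedType.Exports.

Local Open Scope classical_set_scope.
Local Open Scope ring_scope.

(* The library puts the norm topology on the regular algebra [R[i]^o], which is
   convertible to [R[i]]; both spaces below carry their Borel sigma-algebra. *)
Definition borelC (R : realType) := g_sigma_algebraType (@open R[i]^o).

Definition borelC_rV (R : realType) (m : nat) :=
  g_sigma_algebraType (@open 'rV[R[i]^o]_m).

Definition mutually_independent (R : realType) (disp disp' : measure_display)
    (T : measurableType disp) (S : measurableType disp') (P : probability T R)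
    (I : finType) (X : I -> T -> S) : Prop :=
  forall (J : {set I}) (A : I -> set S), (forall i, measurable (A i)) ->
    P (\bigcap_(i in [set` J]) (X i @^-1` A i)) =
    (\prod_(i in J) P (X i @^-1` A i))%E.

Definition zero_mean (R : realType) (disp : measure_display)
    (T : measurableType disp) (P : probability T R) (X : T -> R[i]) : Prop :=
  ('E_P[fun t => complex.Re (X t)] = 0 /\ 'E_P[fun t => complex.Im (X t)] = 0)%E.

(* The law of a random vector only sees its values almost surely, so the bound
   [|w_i| <= l_i] is required almost surely. *)
Definition admissible_noise (R : realType) (m : nat) (l : 'I_m -> R)
    (disp : measure_display) (T : measurableType disp) (P : probability T R)
    (w : {RV P >-> borelC_rV R m}) : Prop :=
  [/\ mutually_independent P
        (fun (i : 'I_m) t => (w t : 'rV[R[i]]_m) 0 i : borelC R),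
      forall i : 'I_m, zero_mean P (fun t => (w t : 'rV[R[i]]_m) 0 i) &
      forall i : 'I_m,
        {ae P, forall t, Normc.normc ((w t : 'rV[R[i]]_m) 0 i) <= l i}].

Definition ambiguity_set (R : realType) (m : nat) (mu : 'rV[R[i]]_m)
    (l : 'I_m -> R) : set (probability (borelC_rV R m) R) :=
  [set Q | exists (disp : measure_display) (T : measurableType disp)
             (P : probability T R) (w d : {RV P >-> borelC_rV R m}),
      [/\ admissible_noise l w,
          forall t, (d t : 'rV[R[i]]_m) = mu + w t &
          Q = distribution P d]].

Definition ztilde (R : realType) (n : nat) (z : 'cV[R[i]]_n) :
  'cV[R[i]]_(n + 1) := col_mx z 1%:M.

Definition phi (R : realType) (n : nat) (z : 'cV[R[i]]_n)
    (d : 'rV[R[i]]_(n + 1)) : R :=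
  complex.Re ((d *m ztilde z) 0 0).

Definition diagL (R : realType) (m : nat) (l : 'I_m -> R) : 'M[R[i]]_m :=
  diag_mx (\row_i real_complex R (l i)).

Definition enorm (R : realType) (m : nat) (v : 'cV[R[i]]_m) : R :=
  Num.sqrt (\sum_i Normc.normc (v i 0) ^+ 2).

(* Main.v *)
(* Hoeffding's inequality.  Up to its mean, phi(z) is the sum of the independent
   centred variables Y_i = Re(w_i z~_i), with |Y_i| <= c_i := l_i |z~_i|, and
   |L z~|^2 = v := sum_i c_i^2.  Convexity of exp and cosh x <= exp(x^2 / 2)
   give E[exp(r Y_i)] <= exp(r^2 c_i^2 / 2); by independence and the Chernoff bound
   at r = a / v, P[sum_i Y_i > a] <= exp(- a^2 / (2 v)), which is at most 1 - p
   for a = - mean, by the certificate.  If v = 0 the noise term vanishes almost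
   surely and the sign of the mean suffices. *)

Require Import Defs.
From HB Require Import structures.
From mathcomp Require Import all_boot all_order all_algebra.
From mathcomp Require Import all_classical all_reals all_analysis.
From mathcomp Require Import measurable_realfun ring lra zify.

Import Order.TTheory GRing.Theory Num.Theory.
Import numFieldNormedType.Exports.

Import HBNNSimple.

Local Open Scope classical_set_scope.
Local Open Scope ring_scope.

Set Implicit Arguments.
Unset Strict Implicit.

(** * Expectations of products of independent factors *)

(* Unlike [cvgeM], this allows the indeterminate product [0 * +oo]. *)
Lemma nondecreasing_cvgeMr (R : realType) (u : (\bar R)^nat) (l w : \bar R) :
  (forall n, 0 <= u n)%E -> nondecreasing_seq u -> u @ \oo --> l ->
  (u n * w)%E @[n --> \oo] --> (l * w)%E.
Proof.
move=> u0 und ul.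
have ule n : (u n <= l)%E.
  have /cvg_lim <- // := ul.
  rewrite (cvg_lim _ (ereal_nondecreasing_cvgn und))//.
  by apply: ereal_sup_ubound; exists n.
(* A zero limit forces every [u n] to be 0, by nonnegativity and monotonicity, so the products
   vanish even when [w] is infinite. *)
have [l0|l0] := eqVneq l 0%E.
  have {}u0 n : u n = 0%E by apply/le_anti; rewrite u0 -l0 ule.
  by rewrite l0; under eq_fun do rewrite u0; exact: cvg_cst.
have [->|w0] := eqVneq w 0%E.
  by rewrite mule0; under eq_fun do rewrite mule0; exact: cvg_cst.
apply: cvgeM => //; last exact: cvg_cst.
by rewrite mule_defE (negbTE l0) (negbTE w0).
Qed.

(** The factorization [XW], known for indicators, passes to simple functions by linearity and to
    nonnegative measurable [g] by monotone convergence. This is the one-variable step towards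
    product formulas under independence. *)
Lemma ge0_integral_comp_mule d d' (T : measurableType d)
    (S : measurableType d') (R : realType) (mu : {measure set T -> \bar R})
    (X : T -> S) (mX : measurable_fun setT X) (W : T -> \bar R)
    (mW : measurable_fun setT W) (W0 : forall t, (0 <= W t)%E) (c : \bar R)
    (c0 : (0 <= c)%E)
    (XW : forall A, measurable A ->
       (\int[mu]_t ((\1_A (X t))%:E * W t) = mu (X @^-1` A) * c)%E)
    (g : S -> \bar R) (mg : measurable_fun setT g)
    (g0 : forall s, (0 <= g s)%E) :
  (\int[mu]_t (g (X t) * W t) = (\int[mu]_t g (X t)) * c)%E.
Proof.
pose h := nnsfun_approx measurableT mg.
have hg s : (fun n => (h n s)%:E) @ \oo --> g s.
  exact: cvg_nnsfun_approx.
have hnd s m n : (m <= n)%N -> ((h m s)%:E <= (h n s)%:E)%E.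
  by move=> mn; rewrite lee_fin; exact/lefP/nd_nnsfun_approx.
have mh n : measurable_fun setT (fun t => (h n (X t))%:E).
  by apply/measurable_EFinP; exact: measurableT_comp.
have simple n : (\int[mu]_t ((h n (X t))%:E * W t) =
    \int[mu]_t ((h n (X t))%:E * c))%E.
  have mXr r : measurable (h n @^-1` [set r]).
    exact: measurable_funPTI.
  have mi1 r : measurable_fun setT (\1_(h n @^-1` [set r]) : S -> R).
    exact: measurable_indic.
  have mi r : measurable_fun setT
      (fun t => ((r * \1_(h n @^-1` [set r]) (X t))%:E : \bar R)).
    apply/measurable_EFinP/measurable_funM => //.
    exact: measurableT_comp (mi1 r) mX.
  have i0 r t : (0 <= (r * \1_(h n @^-1` [set r]) (X t))%:E :> \bar R)%E.
    by rewrite EFinM nnfun_muleindic_ge0.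
  under [LHS]eq_integral => t _.
    rewrite fimfunE -fsumEFin// ge0_mule_fsuml//; over.
  rewrite ge0_integral_fsum//; last 2 first.
  - by move=> r; exact: emeasurable_funM.
  - by move=> r t _; rewrite mule_ge0.
  under [RHS]eq_integral => t _.
    rewrite fimfunE -fsumEFin// ge0_mule_fsuml//; over.
  rewrite ge0_integral_fsum//; last 2 first.
  - by move=> r; exact: emeasurable_funM.
  - by move=> r t _; rewrite mule_ge0.
  (* Only values attained by [h n] are summed, so [r] is nonnegative and comes out of the
     integrals. *)
  apply: eq_fsbigr => r /[!inE] -[s _ <-].
  have r0 : (0 <= (h n s)%:E)%E by rewrite lee_fin fun_ge0.
  have mind : measurable_fun setT
      (fun t => (\1_(h n @^-1` [set h n s]) (X t))%:E : \bar R).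
    by apply/measurable_EFinP; exact: measurableT_comp (mi1 (h n s)) mX.
  under eq_integral do rewrite EFinM -muleA.
  under [RHS]eq_integral do rewrite EFinM -muleA.
  rewrite !ge0_integralZl//; last 4 first.
  - exact: emeasurable_funM.
  - by move=> t _; rewrite mule_ge0.
  - exact: emeasurable_funM.
  - by move=> t _; rewrite mule_ge0.
  rewrite XW// ge0_integralZr//; congr (_ * (_ * _))%E.
  by rewrite -[X @^-1` _]setIT -integral_indic// -[X in measurable X]setTI;
    exact: mX.
(* The weight is left general because both [W] and the constant [c] are substituted for it. *)
have lim w (w0 : forall t, (0 <= w t)%E) (mw : measurable_fun setT w) :
  (\int[mu]_t (g (X t) * w t) =
    limn (fun n => \int[mu]_t ((h n (X t))%:E * w t)))%E.
  rewrite -monotone_convergence//.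
  - apply: eq_integral => t _; apply/esym/cvg_lim => //.
    apply: nondecreasing_cvgeMr => // [n|m n]; last exact: hnd.
    by rewrite lee_fin fun_ge0.
  - by move=> n; exact: emeasurable_funM.
  - by move=> n t _; rewrite mule_ge0// lee_fin.
  - by move=> t _ m n mn; rewrite lee_wpmul2r// hnd.
rewrite -ge0_integralZr//; last exact: measurableT_comp.
by rewrite !lim//; under eq_fun do rewrite simple.
Qed.

Lemma emeasurable_prod d (T : measurableType d) (R : realType) (D : set T)
    (I : Type) (s : seq I) (P : pred I) (f : I -> T -> \bar R) :
  (forall i, P i -> measurable_fun D (f i)) ->
  measurable_fun D (fun t => \prod_(i <- s | P i) f i t)%E.
Proof.
move=> mf; elim: s => [|i s IH].
  by under eq_fun do rewrite big_nil; exact: measurable_cst.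
have [Pi|/negbTE nPi] := boolP (P i); last first.
  by under eq_fun do rewrite big_cons nPi.
under eq_fun do rewrite big_cons Pi.
by apply: emeasurable_funM => //; exact: mf.
Qed.

Lemma prod_indic (T : Type) (R : realType) (I : finType) (A : I -> set T)
    (t : T) :
  (\prod_i (\1_(A i) t)%:E = (\1_(\bigcap_(i in [set` [set: I]%SET]) A i) t)%:E
    :> \bar R)%E.
Proof.
rewrite prodEFin; congr EFin; rewrite indicE; case: (pselect (forall i, A i t)).
  move=> At; rewrite mem_set; last by move=> i _.
  by rewrite big1// => i _; rewrite indicE mem_set.
move=> /existsNP[i Ai]; rewrite memNset => [|/(_ i)]; last first.
  by rewrite /= inE => /(_ isT).
by rewrite (bigD1 i)//= indicE memNset// mul0r.
Qed.

Lemma ge0_integral_prod_independent d d' (T : measurableType d)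
    (S : measurableType d') (R : realType) (P : probability T R)
    (I : finType) (X : I -> T -> S) (indepX : mutually_independent P X)
    (mX : forall i, measurable_fun setT (X i)) (f : I -> S -> \bar R)
    (mf : forall i, measurable_fun setT (f i))
    (f0 : forall i s, (0 <= f i s)%E) :
  (\int[P]_t (\prod_i f i (X i t)) = \prod_i \int[P]_t f i (X i t))%E.
Proof.
(* Indicators are replaced by arbitrary functions one index at a time: [L] lists
   the indices whose function need not be an indicator. *)
suff: forall (L : seq I) (g : I -> S -> \bar R),
    (forall i, measurable_fun setT (g i)) -> (forall i s, (0 <= g i s)%E) ->
    (forall i, i \notin L -> exists2 A, measurable A & g i = EFin \o \1_A) ->
    (\int[P]_t (\prod_i g i (X i t)) = \prod_i \int[P]_t g i (X i t))%E.
  by move=> /(_ (index_enum I) f mf f0); apply => i; rewrite mem_index_enum.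
elim=> [|k L IH] g mg g0 gL.
  have {gL}/choice[A] : forall i, exists A, measurable A /\ g i = EFin \o \1_A.
    by move=> i; have [//|A mA gA] := gL i; exists A.
  move=> /all_and2[mA gA].
  have mXA i : measurable (X i @^-1` A i).
    by rewrite -[X in measurable X]setTI; exact: mX.
  transitivity (\int[P]_t (\1_(\bigcap_(i in [set` [set: I]%SET])
      X i @^-1` A i) t)%:E)%E.
    by apply: eq_integral => t _; rewrite -prod_indic; apply: eq_bigr => i _;
      rewrite gA.
  rewrite integral_indic//; last by apply: fin_bigcap_measurable => // i _.
  rewrite setIT.
  apply: etrans (indepX [set: I]%SET A mA) _.
  rewrite (eq_bigl predT); last by move=> i; rewrite inE.
  apply: eq_bigr => i _; rewrite gA.
  by rewrite -[in LHS](setIT (_ @^-1` _)) -integral_indic.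
(* With the factor at [k] isolated, it suffices to treat an indicator there; the remaining product
   serves as the weight. *)
under eq_integral do rewrite (bigD1 k)//=.
rewrite [RHS](bigD1 k)//=.
apply: (@ge0_integral_comp_mule _ _ _ _ _ _ (X k)) => //.
- by apply: emeasurable_prod => i _; exact: measurableT_comp.
- by move=> t; exact: prode_ge0.
- by apply: prode_ge0 => i _; exact: integral_ge0.
move=> A mA.
(* Once the indicator of [A] sits at [k], every index outside [L] carries an indicator and the
   induction hypothesis applies. *)
pose g' i := if i == k then EFin \o \1_A else g i.
have g'k : g' k = EFin \o \1_A by rewrite /g' eqxx.
have g'N i : i != k -> g' i = g i by rewrite /g' => /negbTE ->.
rewrite [X in _ = (X * _)%E](_ : _ = \int[P]_t g' k (X k t))%E; last first.
  rewrite g'k -[in LHS](setIT (_ @^-1` _)) -integral_indic//.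
  by rewrite -[X in measurable X]setTI; exact: mX.
transitivity (\int[P]_t \prod_i g' i (X i t))%E.
  apply: eq_integral => t _; rewrite [RHS](bigD1 k)//= g'k; congr (_ * _)%E.
  by apply: eq_bigr => i ik; rewrite g'N.
rewrite IH.
- rewrite (bigD1 k)//=; congr (_ * _)%E.
  by apply: eq_bigr => i ik; rewrite g'N.
- move=> i; have [->|/g'N->//] := eqVneq i k; rewrite g'k.
  exact/measurable_EFinP/measurable_indic.
- move=> i s; have [->|/g'N->//] := eqVneq i k.
  by rewrite g'k/= lee_fin.
- move=> i iL; have [->|ik] := eqVneq i k; first by exists A.
  by rewrite g'N//; apply: gL; rewrite inE negb_or ik.
Qed.

(** * Moment generating function of a bounded centred variable *)

(** From [k] to [k + 1] the left side gains the factor [2k + 2], the right side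
    [(2k + 2)(2k + 1)]. *)
Lemma leq_expn2_fact k : (2 ^ k * k`! <= (k.*2)`!)%N.
Proof.
elim: k => // k IH; rewrite doubleS !factS expnS.
rewrite [leqLHS](_ : _ = k.*2.+2 * (2 ^ k * k`!))%N; last first.
  by rewrite -doubleS -mul2n; nia.
by rewrite leq_mul2l/= (leq_trans IH)// leq_pmull.
Qed.

(* Termwise comparison of the power series, by [2 ^ k * k`! <= (2 k)`!]. *)
Lemma cosh_le_expR (R : realType) (x : R) :
  (expR x + expR (- x)) / 2 <= expR (x ^+ 2 / 2).
Proof.
pose c k := (exp_coeff x k + exp_coeff (- x) k) / 2.
have cE k : c k = if odd k then 0 else x ^+ k / k`!%:R.
  rewrite /c /exp_coeff /= exprNn -signr_odd; case: ifPn => kodd.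
    by rewrite mulN1r mulNr subrr mul0r.
  by rewrite expr0 mul1r; lra.
have c0 k : 0 <= c k.
  rewrite cE; case: ifPn => // kev; rewrite -(even_halfK kev).
  by rewrite -muln2 mulnC exprM divr_ge0// exprn_ge0// sqr_ge0.
have sc n :
    series c n = (series (exp_coeff x) n + series (exp_coeff (- x)) n) / 2.
  by rewrite /series/= -big_split/= mulr_suml.
have cvgc : series c @ \oo --> (expR x + expR (- x)) / 2.
  rewrite (funext sc).
  by apply: cvgMr_tmp; apply: cvgD; exact: is_cvg_series_exp_coeff.
(* The odd coefficients vanish, so [2n] terms of the cosh series face [n] terms of the exponential
   series. *)
have le2 n : series c n.*2 <= series (exp_coeff (x ^+ 2 / 2)) n.
  elim: n => [|n IH]; first by rewrite /series/= !big_geq.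
  rewrite doubleS !seriesSr -addrA lerD// !cE/= odd_double addr0.
  rewrite /exp_coeff/= -muln2 mulnC exprM expr_div_n -mulrA.
  rewrite ler_wpM2l ?(exprn_ge0 _ (sqr_ge0 _))//.
  rewrite -invfM lef_pV2 ?posrE ?mulr_gt0 ?exprn_gt0 ?ltr0n ?fact_gt0//.
  by rewrite -natrX -natrM ler_nat mul2n leq_expn2_fact.
have -> : (expR x + expR (- x)) / 2 = limn (series c) by apply/esym/cvg_lim.
apply: limr_le; first exact: cvgP cvgc.
(* Since [c] is nonnegative, [n] terms may be enlarged to [2n], where [le2] applies. *)
apply: nearW => n; apply: (@le_trans _ _ (series c n.*2)).
  apply: (@nondecreasing_series _ c predT 0%N) => [k _ _|]; first exact: c0.
  by rewrite -addnn leq_addr.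
apply: (le_trans (le2 n)); apply: nondecreasing_cvgn_le.
  apply: (@nondecreasing_series _ _ predT 0%N) => k _ _.
  by rewrite exp_coeff_ge0// divr_ge0 ?sqr_ge0.
exact: is_cvg_series_exp_coeff.
Qed.

(** Convexity of exp: [y] is the average of [c] and [- c] with weights [t] and [1 - t]. The chord is
    written as an affine function of [y] so that a zero mean removes its linear term. *)
Lemma expR_le_chord (R : realType) (s c y : R) : 0 < c -> `|y| <= c ->
  expR (s * y) <= (expR (s * c) + expR (- (s * c))) / 2 +
                  (expR (s * c) - expR (- (s * c))) / (2 * c) * y.
Proof.
move=> c0; rewrite ler_norml => /andP[cy yc].
pose t := (c + y) / (2 * c).
have c2 : 0 < 2 * c by rewrite mulr_gt0.
have t0 : 0 <= t by rewrite divr_ge0 ?(ltW c2)// -lerBlDl sub0r.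
have t1 : t <= 1 by rewrite ler_pdivrMr// mul1r mulr2n mulrDl mul1r lerD2l.
have := convex_expR (Itv01 t0 t1) (s * c) (- (s * c)).
rewrite !convRE/= /unstable.onem.
have cN0 : c != 0 by rewrite gt_eqF.
rewrite (_ : t * _ + _ = s * y); last by rewrite /t; field.
by move=> /le_trans; apply; rewrite le_eqVlt; apply/orP; left; apply/eqP;
  rewrite /t; field.
Qed.

Lemma ae_bounded_integrable d (T : measurableType d) (R : realType)
    (P : probability T R) (Y : T -> R) (c : R) :
  measurable_fun setT Y -> {ae P, forall t, `|Y t| <= c} ->
  P.-integrable setT (EFin \o Y).
Proof.
move=> mY Yc; apply/integrableP; split; first exact/measurable_EFinP.
apply: (@le_lt_trans _ _ (\int[P]_t (`|c|)%:E)%E); last first.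
  by rewrite integral_cst//= probability_setT mule1 ltry.
apply: ae_ge0_le_integral => //.
- by apply: measurableT_comp => //; exact/measurable_EFinP.
- by apply: filterS Yc => t Ytc _; rewrite lee_fin (le_trans Ytc)// ler_norm.
Qed.

(** Integrating the chord bound leaves its constant term, cosh of [s * c], which [cosh_le_expR]
    bounds. *)
Lemma hoeffding_mgf d (T : measurableType d) (R : realType)
    (P : probability T R) (Y : T -> R) (c s : R) :
  measurable_fun setT Y -> 0 <= c -> {ae P, forall t, `|Y t| <= c} ->
  (\int[P]_t (Y t)%:E = 0)%E ->
  (\int[P]_t (expR (s * Y t))%:E <= (expR (s ^+ 2 * c ^+ 2 / 2))%:E)%E.
Proof.
move=> mY c0 Yc EY0.
have mE : measurable_fun setT (fun t => (expR (s * Y t))%:E).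
  apply/measurable_EFinP; apply: measurableT_comp => //.
  exact: measurable_funM.
(* The slope of the chord divides by [c]; for [c = 0] the variable is almost surely 0 and is treated
   apart. *)
move: c0; rewrite le_eqVlt => /predU1P[c0|c0].
  rewrite (ae_eq_integral (cst 1%E))//.
    by rewrite integral_cst//= probability_setT mule1 -c0 expr0n mulr0
      mul0r expR0.
  apply: filterS Yc => t + _; rewrite -c0 normr_le0 => /eqP ->.
  by rewrite mulr0 expR0.
pose a := (expR (s * c) + expR (- (s * c))) / 2.
pose b := (expR (s * c) - expR (- (s * c))) / (2 * c).
have iY := ae_bounded_integrable mY Yc.
have mab : measurable_fun setT (fun t => (a + b * Y t)%:E).
  apply/measurable_EFinP/measurable_funD => //; exact: measurable_funM.
have mabN : measurable_fun setT (fun t => (`|a + b * Y t|)%:E).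
  apply/measurable_EFinP; apply: measurableT_comp => //.
  exact/measurable_EFinP.
have chord : {ae P, forall t, expR (s * Y t) <= a + b * Y t}.
  by apply: filterS Yc => t; exact: expR_le_chord.
(* The affine bound is known to be nonnegative only almost surely; its absolute value allows a
   comparison of nonnegative integrals and is then removed almost everywhere. *)
apply: (@le_trans _ _ (\int[P]_t (`|a + b * Y t|)%:E)%E).
  apply: ae_ge0_le_integral => //.
  apply: filterS chord => t abt _; rewrite lee_fin (le_trans abt)//.
  exact: ler_norm.
rewrite (@ae_eq_integral _ _ _ _ _ (fun t => (a + b * Y t)%:E))//; last first.
  apply: filterS chord => t abt _; rewrite ger0_norm//.
  by rewrite (le_trans _ abt)// expR_ge0.
under eq_integral do rewrite EFinD EFinM.
rewrite integralD//; last 2 first.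
- exact: finite_measure_integrable_cst.
- exact: (integrableZl measurableT b iY).
rewrite (integralZl measurableT iY) EY0 mule0 adde0 integral_cst//=.
rewrite probability_setT mule1.
by rewrite lee_fin (le_trans (cosh_le_expR _))// exprMn.
Qed.

(** * Tail bound for sums of independent variables *)

Lemma lee_prod (R : realDomainType) (I : Type) (s : seq I) (P : pred I)
    (x y : I -> \bar R) :
  (forall i, P i -> 0 <= x i <= y i)%E ->
  (\prod_(i <- s | P i) x i <= \prod_(i <- s | P i) y i)%E.
Proof.
move=> xy; suff /andP[] : (0 <= \prod_(i <- s | P i) x i <=
  \prod_(i <- s | P i) y i)%E by [].
elim/big_ind2 : _ => [|x1 x2 y1 y2 /andP[x10 x12] /andP[y10 y12]|//].
  by rewrite lee01 lexx.
by rewrite mule_ge0//= lee_pmul.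
Qed.

(** The summands are functions [y i] of independent variables [X i] in a general space, so
    independence of complex coordinates can be used directly for their real parts. *)
Lemma hoeffding d d' (T : measurableType d) (S : measurableType d')
    (R : realType) (P : probability T R) (I : finType) (X : I -> T -> S)
    (y : I -> S -> R) (c : I -> R) (a : R) :
  mutually_independent P X ->
  (forall i, measurable_fun setT (X i)) ->
  (forall i, measurable_fun setT (y i)) ->
  (forall i, 0 <= c i) ->
  (forall i, {ae P, forall t, `|y i (X i t)| <= c i}) ->
  (forall i, \int[P]_t (y i (X i t))%:E = 0)%E ->
  0 < a -> 0 < \sum_i c i ^+ 2 ->
  (P [set t | (a <= \sum_i y i (X i t))%R] <=
    (expR (- (a ^+ 2 / (2 * \sum_i c i ^+ 2))))%:E)%E.
Proof.
move=> indepX mX my c0 yc Ey a0; set v := \sum_i _ => v0.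
have mZ : measurable_fun setT (fun t => \sum_i y i (X i t)).
  by apply: measurable_sum => i; exact: measurableT_comp.
pose Z : {RV P >-> R} := mfun_Sub (mem_set mZ).
(* This [r] minimizes the Chernoff exponent [r ^+ 2 * v / 2 - r * a]. *)
pose r := a / v.
have r0 : 0 < r by rewrite divr_gt0.
apply: (le_trans (chernoff Z a r0)).
have -> : - (a ^+ 2 / (2 * v)) = r ^+ 2 * v / 2 - r * a.
  by rewrite /r; field; rewrite gt_eqF.
rewrite expRD EFinM lee_pmul2r ?lte_fin ?expR_gt0//.
rewrite /mmt_gen_fun unlock/=.
have -> : (\int[P]_t (expR ((\sum_i y i (X i t)) * r))%:E =
    \int[P]_t (\prod_i (expR (r * y i (X i t)))%:E))%E.
  by apply: eq_integral => t _; rewrite prodEFin -expR_sum -mulr_sumr mulrC.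
rewrite (ge0_integral_prod_independent
  (f := fun i s => (expR (r * y i s))%:E) indepX mX).
- rewrite /v mulr_sumr mulr_suml expR_sum -prodEFin; apply: lee_prod => i _.
  rewrite integral_ge0/=; last by move=> t _; rewrite lee_fin expR_ge0.
  apply: (hoeffding_mgf (c := c i) (Y := fun t => y i (X i t))) => //.
  exact: measurableT_comp.
- move=> i; apply/measurable_EFinP; apply: measurableT_comp => //.
  exact: measurable_funM.
- by move=> i s; rewrite lee_fin expR_ge0.
Qed.

(** * Borel measurability of coordinates and real parts *)

Lemma continuous_borel_measurable (S S' : ptopologicalType) (f : S -> S') :
  continuous f ->
  measurable_fun setT
    (f : g_sigma_algebraType (@open S) -> g_sigma_algebraType (@open S')).
Proof.
move=> cf; apply: (@measurability _ _ (g_sigma_algebraType (@open S))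
  (g_sigma_algebraType (@open S')) setT f (@open S')) => // _ [A oA <-].
by rewrite setTI; apply: sub_sigma_algebra; exact: open_comp.
Qed.

Lemma continuous_Re (R : realType) :
  continuous (@complex.Re R : R[i]^o -> R).
Proof.
move=> x A /nbhs_ballP[e /= e0 eA].
(* Balls of [R[i]^o] have radii in [R[i]], hence the cast of [e]; the real part does not increase
   the norm. *)
apply/nbhs_ballP; exists (real_complex R e); first by rewrite /= ltcR.
move=> y /= xy; apply: eA; move: xy; rewrite -!ball_normE/= => xy.
by rewrite -ltcR (le_lt_trans _ xy)// -raddfB; exact: normc_ge_Re.
Qed.

(** The target [R] carries its own measurable structure rather than [g_sigma_algebraType]; open
    intervals generate it, and their preimages are open. *)
Lemma continuous_borel_measurable_real (S : ptopologicalType) (R : realType)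
    (f : S -> R) :
  continuous f -> measurable_fun setT (f : g_sigma_algebraType (@open S) -> R).
Proof.
move=> cf; apply: (@measurability _ _ (g_sigma_algebraType (@open S))
  (measurableTypeR R) setT f
  (@RGenOpens.G R)); first exact: RGenOpens.measurableE.
move=> _ [_ [x [y ->]] <-]; rewrite setTI; apply: sub_sigma_algebra.
by apply: open_comp => //; exact: itv_open.
Qed.

Lemma measurable_Re_mulr (R : realType) (z : R[i]) :
  measurable_fun setT (fun s : borelC R => complex.Re ((s : R[i]) * z)).
Proof.
apply: (@continuous_borel_measurable_real R[i]^o) => s.
apply: (@continuous_comp _ _ _ (fun s : R[i]^o => (s * z : R[i]^o))).
  exact: mulrr_continuous.
exact: continuous_Re.
Qed.

Lemma measurable_coord (R : realType) m (i : 'I_m) :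
  measurable_fun setT
    (fun v : borelC_rV R m => (v : 'rV[R[i]]_m) 0 i : borelC R).
Proof.
apply: (@continuous_borel_measurable 'rV[R[i]^o]_m R[i]^o).
exact: coord_continuous.
Qed.

(** * Real parts of the noise terms and the norm of [L z~] *)

Lemma le_norm_Re_mulr (R : realType) (s z : R[i]) :
  `|complex.Re (s * z)| <= Normc.normc s * Normc.normc z.
Proof. by rewrite -Normc.normcM -lecR; exact: normc_ge_Re. Qed.

Lemma phiD (R : realType) (n : nat) (z : 'cV[R[i]]_n)
    (u v : 'rV[R[i]]_(n + 1)) :
  phi z (u + v) = phi z u + \sum_i complex.Re (v 0 i * ztilde z i 0).
Proof. by rewrite /phi mulmxDl mxE raddfD/= [(v *m _) 0 0]mxE raddf_sum. Qed.

Lemma enorm_diagL (R : realType) (m : nat) (l : 'I_m -> R) (v : 'cV[R[i]]_m) :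
  enorm (diagL l *m v) =
  Num.sqrt (\sum_i (l i * Normc.normc (v i 0)) ^+ 2).
Proof.
rewrite /enorm; congr Num.sqrt; apply: eq_bigr => i _.
rewrite /diagL mul_diag_mx !mxE Normc.normcM !exprMn; congr (_ * _).
by rewrite /= expr0n addr0 sqr_sqrtr ?sqr_ge0.
Qed.

(** [Re (W z)] is a real linear combination of [Re W] and [Im W], both of mean 0; the almost sure
    bound supplies the integrability needed for linearity. *)
Lemma zero_mean_Re_mulr d (T : measurableType d) (R : realType)
    (P : probability T R) (W : T -> R[i]) (z : R[i]) (c : R) :
  measurable_fun setT (W : T -> borelC R) ->
  {ae P, forall t, Normc.normc (W t) <= c} -> zero_mean P W ->
  (\int[P]_t (complex.Re (W t * z))%:E = 0)%E.
Proof.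
move=> mW Wc [].
have mRe u : measurable_fun setT (fun t => complex.Re (W t * u)).
  exact: (measurableT_comp (measurable_Re_mulr u) mW).
have iRe u : P.-integrable setT (EFin \o (fun t => complex.Re (W t * u))).
  apply: (ae_bounded_integrable (c := c * Normc.normc u)) => //.
  apply: filterS Wc => t Wtc; apply: (le_trans (le_norm_Re_mulr _ _)).
  by rewrite ler_wpM2r// -lecR; exact: (normr_ge0 u).
have Re1 (s : R[i]) : complex.Re s = complex.Re (s * 1) by rewrite mulr1.
(* Writing the imaginary part as a real part lets [mRe] and [iRe] cover both. *)
have Im1 (s : R[i]) : complex.Im s = complex.Re (s * - 'i%C).
  by rewrite mulrN raddfN/= ReiNIm opprK.
rewrite !unlock.
under eq_integral do rewrite /= Re1; move=> Re0.
under eq_integral do rewrite /= Im1; move=> Im0.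
have ReM (s : R[i]) : (complex.Re (s * z))%:E =
    ((complex.Re z)%:E * (complex.Re (s * 1))%:E +
     (- complex.Im z)%:E * (complex.Re (s * - 'i%C))%:E)%E.
  rewrite -!EFinM -EFinD -Re1 -Im1; congr EFin.
  by case: s => s1 s2; case: (z) => z1 z2 /=; ring.
under eq_integral do rewrite ReM.
rewrite (integralD measurableT
  (integrableZl measurableT _ (iRe 1)) (integrableZl measurableT _ (iRe _))).
rewrite (integralZl measurableT (iRe 1)) (integralZl measurableT (iRe _)).
by rewrite Re0 Im0 !mule0 adde0.
Qed.

(** * From the certificate to the chance constraint *)

(** The logarithm is positive as [0 < p < 1], which gives [0 < a]; squaring the hypothesis and
    exponentiating gives the bound. *)
Lemma expR_certificate (R : realType) (p v a : R) : 0 < p < 1 -> 0 < v ->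
  Num.sqrt (2 * ln (1 / (1 - p))) * Num.sqrt v <= a ->
  0 < a /\ expR (- (a ^+ 2 / (2 * v))) <= 1 - p.
Proof.
move=> /andP[p0 p1] v0.
have q0 : 0 < 1 - p by rewrite subr_gt0.
have q1 : 1 - p < 1 by rewrite ltrBlDr ltrDl.
have ln0 : 0 < ln (1 / (1 - p)).
  by rewrite div1r lnV// oppr_gt0 ln_lt0// q0.
set s := Num.sqrt _ => sa.
have s0 : 0 < s by rewrite sqrtr_gt0 mulr_gt0.
have a0 : 0 < a by rewrite (lt_le_trans _ sa)// mulr_gt0// sqrtr_gt0.
split=> //; rewrite -[leRHS]lnK ?posrE// ler_expR lerNl.
rewrite -lnV ?posrE// -div1r ler_pdivlMr ?mulr_gt0//.
rewrite (_ : _ * _ = (s * Num.sqrt v) ^+ 2); last first.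
  by rewrite exprMn !sqr_sqrtr ?ltW// ?mulr_gt0// ?mulrA//; ring.
by rewrite ler_sqr// nnegrE ltW// mulr_gt0// sqrtr_gt0.
Qed.

Theorem theorem5p6 (R : realType) (n : nat) (mu_d : 'rV[R[i]]_(n + 1))
    (l : 'I_(n + 1) -> R) (l_ge0 : forall i, 0 <= l i)
    (z : 'cV[R[i]]_n) (p : R) (p01 : 0 < p < 1)
    (mean_le0 : phi z mu_d <= 0)
    (cert : Num.sqrt (2 * ln (1 / (1 - p))) * enorm (diagL l *m ztilde z)
            + phi z mu_d <= 0) :
  (p%:E <= ereal_inf [set Q [set d | (phi z d <= 0)%R] |
                       Q in ambiguity_set mu_d l])%E.
Proof.
apply: le_ereal_inf_tmp => _ [Q [disp [T [P [w [d [[wind w0 wl] dE ->]]]]]] <-].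
pose X i t : borelC R := (w t : 'rV[R[i]]_(n + 1)) 0 i.
pose y i (s : borelC R) : R := complex.Re ((s : R[i]) * ztilde z i 0).
pose c i := l i * Normc.normc (ztilde z i 0).
pose a := - phi z mu_d.
have mX i : measurable_fun setT (X i).
  exact: (measurableT_comp (measurable_coord i) (measurable_funPT w)).
have my i : measurable_fun setT (y i) by exact: measurable_Re_mulr.
have nz0 i : 0 <= Normc.normc (ztilde z i 0).
  by rewrite -lecR; exact: (normr_ge0 (ztilde z i 0)).
have c0 i : 0 <= c i by rewrite mulr_ge0.
have yc i : {ae P, forall t, `|y i (X i t)| <= c i}.
  apply: filterS (wl i) => t wlt; apply: (le_trans (le_norm_Re_mulr _ _)).
  by rewrite ler_wpM2r.
have Ey i : (\int[P]_t (y i (X i t))%:E = 0)%E.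
  exact: zero_mean_Re_mulr (mX i) (wl i) (w0 i).
have mZ : measurable_fun setT (fun t => \sum_i y i (X i t)).
  by apply: measurable_sum => i; exact: measurableT_comp.
rewrite /distribution/= /pushforward/=.
(* By [phiD] the constraint fails exactly when the noise sum exceeds [a], so the goal becomes
   [P bad <= 1 - p]. *)
pose bad := [set t | a < \sum_i y i (X i t)].
have mbad : measurable bad.
  rewrite (_ : bad = setT `&` (fun t => \sum_i y i (X i t)) @^-1` `]a, +oo[).
    exact: mZ.
  by rewrite setTI; apply/seteqP; split => t; rewrite /= in_itv/= andbT.
have -> : d @^-1` [set d | phi z d <= 0] = ~` bad.
  apply/seteqP; split => t /=; rewrite dE phiD -lerBrDl sub0r -/a => ta.
    by apply/negP; rewrite -leNgt.
  by rewrite leNgt; apply/negP.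
rewrite probability_setC// leeBrDr ?fin_num_measure// addeC -leeBrDr//.
rewrite -EFinB.
have a_ge : Num.sqrt (2 * ln (1 / (1 - p))) * Num.sqrt (\sum_i c i ^+ 2) <= a.
  by move: cert; rewrite enorm_diagL -lerBrDr sub0r.
have : 0 <= \sum_i c i ^+ 2 by apply: sumr_ge0 => i _; exact: sqr_ge0.
(* If the variance proxy is 0, all [c i] vanish, the noise sum is almost surely 0, and [mean_le0]
   makes [bad] negligible. *)
rewrite le_eqVlt => /predU1P[v0|v0].
  have ci0 i : c i = 0.
    apply/eqP; rewrite -sqrf_eq0; move/esym/eqP: v0.
    rewrite psumr_eq0 => [/allP/(_ i (mem_index_enum i))//|? _].
    exact: sqr_ge0.
  rewrite measure_negligible//.
    by rewrite lee_fin subr_ge0; case/andP: p01 => _ /ltW.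
  suff : {ae P, forall t, ~ bad t}.
    by apply: negligibleS => t /= bt; apply.
  (* The index set is finite, so the almost sure bounds hold simultaneously. *)
  have : {ae P, forall t, forall i, `|y i (X i t)| <= c i}.
    exact: filter_forall.
  apply: filterS => t yt0; rewrite /bad/= big1 => [|i _].
    by rewrite oppr_lt0 ltNge mean_le0.
  by apply/eqP; rewrite -normr_le0 -(ci0 i).
have [a0 expa] := expR_certificate p01 v0 a_ge.
apply: (@le_trans _ _ (expR (- (a ^+ 2 / (2 * \sum_i c i ^+ 2))))%:E);
  last by rewrite lee_fin.
(* The strict event [bad] lies in the closed event of the tail bound. *)
apply: le_trans (hoeffding wind mX my c0 yc Ey a0 v0).
rewrite le_measure ?inE//; last by move=> t /ltW.
rewrite (_ : [set _ | _] =
  setT `&` (fun t => \sum_i y i (X i t)) @^-1` `[a, +oo[).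
  exact: mZ.
by rewrite setTI; apply/seteqP; split => t; rewrite /= in_itv/= andbT.
Qed.
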